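(* Let $n\ge 3$ and $r\ge 0$ be integers, put $m=r+1$, and let $p$ be a prime with $p>n$ and $m\mid p-1$. Let $\mathcal M_{\max}=\{M\in\mathcal M:\mu_1(M)=q(M)\ge 2\}$. Then $$H_n(r)=m^{1-n}\sum_{M\in\mathcal M_{\max}}\frac{\operatorname{mult}(M)}{\eta(M)}\,\Theta(M)\quad\text{in }\mathbb F_p .$$ Moreover, restricting this sum to a scaling-invariant family gives that family's contribution: if $\mathcal F\subseteq\mathcal M$ satisfies $\lambda M\in\mathcal F$ for all $M\in\mathcal F$ and $\lambda\in\Omega$, then $$m^{-n}\sum_{M\in\mathcal F}\operatorname{mult}(M)\Theta(M)=m^{1-n}\sum_{M\in\mathcal F\cap\mathcal M_{\max}}\frac{\operatorname{mult}(M)}{\eta(M)}\,\Theta(M)\quad\text{in }\mathbb F_p .$$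
   Context: $H_n(r)$ is the number of $n\times n$ matrices with nonnegative integer entries all of whose row sums and column sums equal $r$; in an identity in $\mathbb F_p$ integers are reduced modulo $p$. $\Omega=\{a\in\mathbb F_p:a^m=1\}$, which has exactly $m$ elements. $\mathcal M$ is the set of multisets of size $n$ with elements in $\Omega$. For $M\in\mathcal M$, $\mu_a=\mu_a(M)$ is the multiplicity of $a$ in $M$ and $\operatorname{supp}(M)$ is the set of distinct elements of $M$. $h_r(x_1,\dots,x_n)=\sum_{\alpha_1+\cdots+\alpha_n=r,\ \alpha_i\ge0}x_1^{\alpha_1}\cdots x_n^{\alpha_n}$ is the complete homogeneous symmetric polynomial, and $h_r(M)$ is its value on the entries of $M$ (with multiplicity). Further $$\operatorname{mult}(M)=\frac{n!}{\prod_a\mu_a!},\qquad \Theta(M)=\Big(\prod_a a^{\mu_a}\Big)h_r(M)^n,$$ $$q(M)=\max_{a\in\operatorname{supp}(M)}\mu_a,\qquad \eta(M)=\#\{a:\mu_a=q(M)\}.$$ The scaling action is $\lambda\cdot M=\lambda M$ (multiply every entry by $\lambda\in\Omega$). The contribution of a family $\mathcal F\subseteq\mathcal M$ (to the root average) is $m^{-n}\sum_{M\in\mathcal F}\operatorname{mult}(M)\Theta(M)$. *)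

(* Defs.v *)
From mathcomp Require Import all_boot all_order all_algebra.
From mathcomp Require Import finmap multiset mpoly.

Set Implicit Arguments.
Unset Strict Implicit.
Unset Printing Implicit Defensive.

Import GRing.Theory.
Local Open Scope fset_scope.
Local Open Scope mset_scope.
Local Open Scope ring_scope.

(* Number of n x n magic squares of line sum r.  For n > 0 an entry never
   exceeds its row sum, so bounding the entries by r loses no matrix. *)
Definition magic_count (n r : nat) : nat :=
  #|[set A : 'M['I_r.+1]_n |
      [forall i, (\sum_j A i j)%N == r] && [forall j, (\sum_i A i j)%N == r]]|.

Definition complete_sym (R : comNzRingType) (n r : nat) : {mpoly R[n]} :=
  \sum_(alpha : 'X_{1..n < r.+1} | mdeg alpha == r) 'X_[alpha].

Section RootMultisets.
Variables (p n m : nat).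
Implicit Types (M : {mset 'F_p}) (F : {fset {mset 'F_p}}).

Definition Omega : {set 'F_p} := [set a | a ^+ m == 1].

Definition root_msets : {fset {mset 'F_p}} :=
  [fset seq_mset (tval t)
     | t in [set t : n.-tuple 'F_p | all (fun a => a \in Omega) t]].

Lemma root_msetsP M :
  reflect (size M = n /\ {subset M <= Omega}) (M \in root_msets).
Proof.
apply: (iffP (imfsetP _ _ _ _)) => /= [[t]|[szM MO]].
  rewrite inE => /allP tO ->; split.
    by rewrite (perm_size (perm_eq_seq_mset _)) size_tuple.
  by move=> a; rewrite (perm_mem (perm_eq_seq_mset _)); apply: tO.
exists (tcast szM (in_tuple M)); rewrite ?inE val_tcast /=; first exact/allP.
by rewrite seq_mset_id.
Qed.

Definition multinom_coef M : nat :=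
  (n`! %/ \prod_(a <- finsupp M) (M a)`!)%N.

(* The complete homogeneous polynomial is symmetric, so its value does not
   depend on the order in which [M] lists its entries. *)
Definition complete_sym_at (r : nat) M : 'F_p :=
  (complete_sym 'F_p n r).@[fun i => nth 0 M i].

Definition Theta (r : nat) M : 'F_p :=
  (\prod_(a <- finsupp M) a ^+ M a) * complete_sym_at r M ^+ n.

Definition max_mult M : nat := (\max_(a <- finsupp M) M a)%N.

Definition num_max M : nat := #|[set a : 'F_p | M a == max_mult M]|.

Definition scale_mset (l : 'F_p) M : {mset 'F_p} :=
  seq_mset [seq l * a | a <- M].

Definition scaling_invariant F : Prop :=
  forall M (l : 'F_p), M \in F -> l \in Omega -> scale_mset l M \in F.

Definition max_root_msets : {fset {mset 'F_p}} :=
  [fset M in root_msets | (M 1 == max_mult M) && (2 <= max_mult M)%N].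

Definition contribution (r : nat) F : 'F_p :=
  m%:R ^ (- n%:Z) * \sum_(M <- F) (multinom_coef M)%:R * Theta r M.

End RootMultisets.

(* Main.v *)
Require Import Defs.
From mathcomp Require Import all_boot all_order all_algebra.
From mathcomp Require Import cyclic finfield.
From mathcomp Require Import finmap multiset mpoly.

(* Averaging [x_1 ... x_n h_r(x)^n] over [Omega^n] keeps only the monomials
   whose exponents are all divisible by [m = r + 1]; by degree these have exponent
   [m] in every variable, and they are counted by the magic squares.  Grouping the
   tuples by their multiset of entries turns this average into the contribution of
   the family of all multisets.  A multiset of distinct roots of unity has
   [h_r = 0].  On the others [mult], [q], [eta] and [Theta] are scaling invariant,
   and counting the pairs [(M, a)] with [mu_a = q(M)] in two ways moves [a] to [1],
   at the price of the factor [m / eta]. *)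

Set Implicit Arguments.
Unset Strict Implicit.
Unset Printing Implicit Defensive.

Import GRing.Theory.

Local Open Scope fset_scope.
Local Open Scope mset_scope.
Local Open Scope ring_scope.

(** * Orderings of a finite sequence *)

(** Induction on the first letter [x]: erasing it divides the factorial of [x] by [count_mem x s].
    The list [r] may exceed the support, since [0! = 1], so it stays fixed when the last copy of a
    letter disappears. *)
Lemma size_permutationsM (T : eqType) (r s : seq T) :
  uniq r -> {subset s <= r} ->
  (size (permutations s) * \prod_(a <- r) (count_mem a s)`!)%N = ((size s)`!)%N.
Proof.
move=> r_uniq; have [k] := ubnP (size s); elim: k s => // k IHk s /ltnSE le_s_k sr.
have [s0|s_gt0] := posnP (size s).
  by rewrite (size0nil s0) big1.
have /perm_size -> := permutationsE s_gt0.
rewrite size_allpairs_dep sumnE big_map big_distrl /=.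
transitivity (\sum_(x <- undup s) count_mem x s * (size s).-1`!)%N.
  rewrite big_seq [RHS]big_seq; apply: eq_bigr => x; rewrite mem_undup => sx.
  have perm_s := perm_to_rem sx.
  have <- : (size (permutations (rem x s)) *
    \prod_(a <- r) (count_mem a (rem x s))`! = (size s).-1`!)%N.
    rewrite IHk ?size_rem //; first by rewrite prednK.
    by move=> y /mem_rem/sr.
  rewrite mulnCA; congr (_ * _)%N; rewrite !(bigD1_seq x) ?sr //= mulnA.
  rewrite (permP perm_s) /= eqxx add1n factS; congr (_ * _)%N.
  apply: eq_bigr => a ax; rewrite (permP perm_s) /=.
  by rewrite eq_sym (negPf ax).
rewrite -big_distrl /= -[in RHS](prednK s_gt0) factS prednK //; congr (_ * _)%N.
rewrite -[RHS](perm_size (perm_count_undup s)) size_flatten /shape -map_comp.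
by rewrite sumnE big_map; apply: eq_bigr => x _; rewrite /= size_nseq.
Qed.

(** * Values of [h_r] as coefficients of products of geometric polynomials *)

Lemma complete_sym_eval (R : comNzRingType) n r (v : 'I_n -> R) :
  (complete_sym R n r).@[v] =
  \sum_(f : {ffun 'I_n -> 'I_r.+1} | (\sum_i f i)%N == r) \prod_i v i ^+ f i.
Proof.
rewrite /complete_sym rmorph_sum /=.
have m0lt : (mdeg (0%MM : 'X_{1..n}) < r.+1)%N by rewrite mdeg0.
have b_le (b : 'X_{1..n < r.+1}) i : (b i < r.+1)%N.
  by rewrite (leq_ltn_trans _ (bmdeg b)) // mdegE (bigD1 i) ?leq_addr.
(* The default exponent [0] arises only when [f] sums to more than [r], which the condition of the
   sum excludes. *)
pose B (f : {ffun 'I_n -> 'I_r.+1}) : 'X_{1..n < r.+1} :=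
  insubd (BMultinom m0lt) [multinom (f i : nat) | i < n].
have mdegB (f : {ffun _ -> 'I_r.+1}) :
    mdeg [multinom (f i : nat) | i < n] = (\sum_i f i)%N.
  by rewrite mdegE; apply: eq_bigr => i _; rewrite mnmE.
rewrite [RHS](reindex_onto (fun b : 'X_{1..n < r.+1} => [ffun i => inord (b i)]) B).
  apply: eq_big => [b|b _].
    have -> : B [ffun i => inord (b i)] = b.
      apply: val_inj; rewrite val_insubd.
      suff -> : [multinom ([ffun i => inord (b i)] i : 'I_r.+1) : nat | i < n] =
        b :> 'X_{1..n} by rewrite bmdeg.
      by apply/mnmP => i; rewrite mnmE ffunE inordK.
    rewrite eqxx andbT mdegE; congr (_ == r); apply: eq_bigr => i _.
    by rewrite ffunE inordK.
  by rewrite mevalX; apply: eq_bigr => i _; rewrite ffunE inordK.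
move=> f /eqP f_r; apply/ffunP => i; apply: val_inj.
by rewrite ffunE /= inordK // /B val_insubd mdegB f_r ltnSn mnmE.
Qed.

(** Expanding the product chooses an exponent [f i] in each factor, and the degree is their sum. *)
Lemma coef_prod_geometric (R : comNzRingType) n r (v : 'I_n -> R) :
  (\prod_i \poly_(k < r.+1) v i ^+ k)`_r =
  \sum_(f : {ffun 'I_n -> 'I_r.+1} | (\sum_i f i)%N == r) \prod_i v i ^+ f i.
Proof.
under eq_bigr do rewrite poly_def.
rewrite bigA_distr_bigA coef_sum [RHS]big_mkcond; apply: eq_bigr => f _ /=.
rewrite scaler_prod prodrXr coefZ coefXn eq_sym.
by case: eqP; rewrite ?mulr1 ?mulr0.
Qed.

Lemma complete_sym_eval_nth (R : comNzRingType) n r (s : seq R) : size s = n ->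
  (complete_sym R n r).@[fun i => nth 0 s i] =
  (\prod_(a <- s) \poly_(k < r.+1) a ^+ k)`_r.
Proof.
by move=> <-; rewrite complete_sym_eval -coef_prod_geometric (big_nth 0) big_mkord.
Qed.

(* With [m = r.+1] and [n = size s], ['X^m - 1] is a constant times ['X - a^-1]
   times the geometric polynomial of [a]; so the product below is a constant times
   [('X^m - 1) ^+ n.-1] times a polynomial of degree [m - n], and has no term of
   degree [m - 1]. *)
Lemma coef_prod_geometric_uniq (F : fieldType) r (s : seq F) :
  (1 < size s)%N -> uniq s -> all (fun a => a ^+ r.+1 == 1) s ->
  (\prod_(a <- s) \poly_(k < r.+1) a ^+ k)`_r = 0.
Proof.
move=> s_gt1 s_uniq /allP s1.
have a0 a : a \in s -> a != 0.
  by move=> /s1; apply: contraTneq => ->; rewrite expr0n eq_sym oner_neq0.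
have P_geom a : a \in s ->
  (\poly_(k < r.+1) a ^+ k) * ('X - a^-1%:P) = a^-1%:P * ('X^(r.+1) - 1).
  move=> sa; have /eqP a1 := s1 a sa.
  have -> : 'X - a^-1%:P = a^-1%:P * (a *: 'X - 1) :> {poly F}.
    by rewrite mulrBr mulr1 -mul_polyC mulrA -rmorphM /= mulVf ?mul1r ?a0.
  rewrite mulrCA; congr (_ * _); rewrite mulrC -[X in _ = X - 1]scale1r.
  rewrite -a1 -exprZn subrX1 poly_def; congr (_ * _).
  by apply: eq_bigr => k _; rewrite exprZn.
have roots_s : all (root ('X^(r.+1) - 1)) [seq a^-1 | a <- s].
  apply/allP => _ /mapP[a /s1/eqP a1 ->].
  by rewrite rootE !hornerE exprVn a1 invr1 subrr.
have [|Q defQ] := uniq_roots_prod_XsubC roots_s.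
  by rewrite uniq_rootsE map_inj_uniq //; apply: invr_inj.
set D := \prod_(z <- _) _ in defQ.
have D_monic : D \is monic by apply: monic_prod_XsubC.
have sizeD : size D = (size s).+1 by rewrite size_prod_XsubC size_map.
(* Multiplying by [D] gives each geometric factor its linear factor ['X - a^-1]; being monic, [D]
   cancels afterwards. *)
have {P_geom} : (\prod_(a <- s) \poly_(k < r.+1) a ^+ k) * D =
    (\prod_(a <- s) a^-1)%:P * (('X^(r.+1) - 1) ^+ (size s).-1 * Q) * D.
  rewrite -!mulrA -defQ -exprSr prednK ?(ltn_trans _ s_gt1) //.
  rewrite -iter_mulr_1 -(count_predT s) -big_const_seq rmorph_prod /=.
  rewrite /D big_map -!big_split /=.
  by rewrite big_seq [RHS]big_seq; apply: eq_bigr => a /P_geom.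
move/(mulIf (monic_neq0 D_monic)) => ->; rewrite coefCM.
have Q0 : Q != 0.
  apply: contra_eq_neq defQ => ->; rewrite mul0r -size_poly_eq0.
  by rewrite -polyC1 size_XnsubC.
(* Comparing sizes, [size Q + size s = r + 2] with [size s >= 2], so [Q] has degree below [r]. *)
have Qr : Q`_r = 0.
  apply: nth_default; have := congr1 (fun P : {poly F} => size P) defQ.
  rewrite -polyC1 size_XnsubC // size_Mmonic // sizeD addnS /= => rE.
  by rewrite -2!ltnS rE -addn2 leq_add2l.
rewrite [X in _ * X](_ : _ = 0) ?mulr0 //.
(* Each factor ['X^(r.+1) - 1] only flips the sign of the coefficient of degree [r]. *)
elim: _.-1 => [|k IHk]; first by rewrite mul1r.
by rewrite exprS -mulrA mulrBl mul1r coefB coefXnM ltnSn IHk subr0.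
Qed.

(** * Averaging over roots of unity, and magic squares *)

(** By Fermat the [p - 1] nonzero elements are roots of unity of order dividing [p - 1], so one of
    them is primitive; its power [(p - 1) / m] is the witness. *)
Lemma primitive_root_Fp p m : prime p -> (m %| p - 1)%N ->
  exists z : 'F_p, m.-primitive_root z.
Proof.
rewrite subn1 => p_pr m_dvd.
have p1_gt0 : (0 < p.-1)%N by rewrite -ltnS prednK ?prime_gt1 ?prime_gt0.
have : has (p.-1).-primitive_root (enum (predC1 (0 : 'F_p))).
  apply: has_prim_root; rewrite ?enum_uniq -?cardE ?cardC1 ?card_Fp //.
  apply/allP => a; rewrite mem_enum inE => a0; rewrite unity_rootE.
  apply/eqP/(mulfI a0); rewrite -exprS prednK ?prime_gt0 // mulr1.
  by rewrite -[RHS]expf_card card_Fp.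
by case/hasP => z _ z_prim; exists (z ^+ (p.-1 %/ m)); apply: dvdn_prim_root.
Qed.

(** Orthogonality: with [w = z ^+ k] the sum is geometric, and [w - 1] times it is
    [w ^+ m - 1 = 0]. *)
Lemma sum_Omega_expr p m (z : 'F_p) k : m.-primitive_root z ->
  \sum_(a in Omega p m) a ^+ k = if (m %| k)%N then m%:R else 0.
Proof.
move=> z_prim; have m_gt0 := prim_order_gt0 z_prim.
have -> : Omega p m = [set z ^+ (i : 'I_m) | i in 'I_m].
  apply/setP => a; rewrite inE; apply/eqP/imsetP => [/(prim_rootP z_prim)[i ->]|].
    by exists i.
  by case=> i _ ->; rewrite exprAC (prim_expr_order z_prim) expr1n.
rewrite big_imset /=; last first.
  move=> i j _ _ /eqP; rewrite (eq_prim_root_expr z_prim) !modn_small //.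
  by move/eqP/val_inj.
under eq_bigr do rewrite exprAC.
rewrite (prim_order_dvd z_prim); case: eqP => [->|/eqP zk].
  under eq_bigr do rewrite expr1n.
  by rewrite sumr_const card_ord.
apply: (mulfI (_ : z ^+ k - 1 != 0)); first by rewrite subr_eq0.
by rewrite -subrX1 mulr0 exprAC (prim_expr_order z_prim) expr1n subrr.
Qed.

(** Divisibility of the positive [(c i).+1] forces [c i >= r], and the total leaves no room for a
    strict inequality. The successor comes from the factor [x_1 ... x_n]. *)
Lemma col_sums_dvdn n r (c : 'I_n -> nat) : (\sum_i c i)%N = (n * r)%N ->
  [forall i, (r.+1 %| (c i).+1)%N] = [forall i, c i == r].
Proof.
move=> sum_c; apply/forallP/forallP => [dvd_c|c_r i]; last by rewrite (eqP (c_r i)).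
have r_le i : true -> (r <= c i ?= iff (r == c i))%N.
  by move=> _; split=> //; rewrite -ltnS dvdn_leq.
move=> i; have [_] := leqif_sum r_le.
rewrite sum_c sum_nat_const card_ord eqxx => /esym/forallP/(_ i).
by rewrite eq_sym.
Qed.

(** A family of rows is the form in which [bigA_distr_big] expands the power [h_r ^+ n]. *)
Lemma magic_countE n r : magic_count n r =
  #|[set A : {ffun 'I_n -> {ffun 'I_n -> 'I_r.+1}} |
     [forall i, (\sum_j A i j)%N == r] && [forall j, (\sum_i A i j)%N == r]]|.
Proof.
pose mx (A : {ffun 'I_n -> {ffun 'I_n -> 'I_r.+1}}) : 'M_n := \matrix_(i, j) A i j.
have mx_inj : injective mx.
  move=> A B /matrixP AB; apply/ffunP => i; apply/ffunP => j.
  by have := AB i j; rewrite !mxE.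
rewrite -(card_imset _ mx_inj); congr #|pred_of_set _|; apply/setP => A.
apply/idP/imsetP => [|[B]]; rewrite inE.
  move=> A_magic; exists [ffun i => [ffun j => A i j]].
    rewrite inE; apply: etrans A_magic.
    by congr (_ && _); apply: eq_forallb => i; congr (_ == _);
       apply: eq_bigr => j _; rewrite !ffunE.
  by apply/matrixP => i j; rewrite !mxE !ffunE.
move=> B_magic ->; apply: etrans B_magic.
by rewrite inE; congr (_ && _); apply: eq_forallb => i; congr (_ == _);
   apply: eq_bigr => j _; rewrite !mxE.
Qed.

Lemma root_average n r p (z : 'F_p) : (r.+1).-primitive_root z ->
  \sum_(f in ffun_on (mem (Omega p r.+1)))
     (\prod_(i < n) f i) * (complete_sym 'F_p n r).@[f] ^+ n =
  (r.+1)%:R ^+ n * (magic_count n r)%:R.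
Proof.
move=> z_prim.
pose rows := [pred g : {ffun 'I_n -> 'I_r.+1} | (\sum_i g i)%N == r].
(* Row [k] of [A] is the monomial taken from the [k]-th factor [h_r]; the variable [f i] collects
   the sum of column [i], plus one. *)
transitivity (\sum_(A in ffun_on rows) \sum_(f in ffun_on (mem (Omega p r.+1)))
    \prod_(i < n) f i ^+ (\sum_(k < n) A k i).+1).
  rewrite exchange_big /=; apply: eq_bigr => f _.
  rewrite complete_sym_eval -[X in _ ^+ X](card_ord n) -prodr_const.
  rewrite (bigA_distr_big rows) big_distrr /=.
  apply: eq_bigr => A _; rewrite exchange_big -big_split /=.
  by apply: eq_bigr => i _; rewrite exprS prodrXr.
(* For fixed [A] the sum over [f] splits into one sum over [Omega] per variable, to which
   orthogonality applies. *)
transitivity (\sum_(A in ffun_on rows)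
    if [forall i, \sum_(k < n) A k i == r]%N then (r.+1)%:R ^+ n else 0 : 'F_p).
  apply: eq_bigr => A /ffun_onP A_rows.
  rewrite -(bigA_distr_big (mem (Omega p r.+1))
    (fun i a => a ^+ (\sum_(k < n) A k i).+1)).
  under eq_bigr do rewrite (sum_Omega_expr _ z_prim).
  rewrite -col_sums_dvdn.
    case: forallP => [dvd_c|/forallP].
      under eq_bigr do rewrite dvd_c.
      by rewrite prodr_const card_ord.
    rewrite negb_forall => /existsP[i /negPf ndvd].
    by rewrite (bigD1 i) //= ndvd mul0r.
  rewrite exchange_big /= -[X in _ = (X * _)%N]card_ord -sum_nat_const.
  by apply: eq_bigr => k _; apply/eqP/(A_rows k).
rewrite -big_mkcondr /= sumr_const mulr_natr magic_countE.
congr (_ *+ _); rewrite cardsE; apply: eq_card => A.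
rewrite ![LHS]unfold_in ![RHS]unfold_in.
by congr (_ && _); apply/ffun_onP/forallP.
Qed.

(** * From tuples to multisets, and invariance under scaling *)

Lemma coef_prod_geometric_scale (R : comNzRingType) r (l : R) (s : seq R) :
  (\prod_(a <- s) \poly_(k < r.+1) (l * a) ^+ k)`_r =
  l ^+ r * (\prod_(a <- s) \poly_(k < r.+1) a ^+ k)`_r.
Proof.
rewrite (big_nth 0) big_mkord.
rewrite [\prod_(a <- s) \poly_(k < _) a ^+ k](big_nth 0) big_mkord.
rewrite (coef_prod_geometric r (fun i : 'I_(size s) => l * nth 0 s i)).
rewrite coef_prod_geometric big_distrr /=.
apply: eq_bigr => f /eqP f_r; rewrite -[X in l ^+ X]f_r -prodrXr -big_split /=.
by apply: eq_bigr => i _; rewrite exprMn.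
Qed.

Section RootMultisets.
Variables (p n r : nat).
Implicit Types (M : {mset 'F_p}) (l a : 'F_p).

(** Both factors become products over the list of entries, so [perm_big] may replace [M] by any
    reordering. *)
Lemma Theta_seq M : size M = n ->
  Theta n r M =
  (\prod_(a <- M) a) * ((\prod_(a <- M) \poly_(k < r.+1) a ^+ k)`_r) ^+ n.
Proof.
move=> szM; rewrite /Theta /complete_sym_at complete_sym_eval_nth //.
by rewrite [in RHS]big_mset.
Qed.

Lemma multinom_coefE M : size M = n ->
  multinom_coef n M = size (permutations M).
Proof.
move=> szM; rewrite /multinom_coef -szM.
rewrite -(@size_permutationsM _ (finsupp M) M) ?fset_uniq //; last first.
  by move=> a; rewrite multiset.msuppE.
under eq_bigr do rewrite count_mem_mset.
by rewrite mulnK // prodn_gt0 // => a; rewrite fact_gt0.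
Qed.

Lemma sum_root_tuples m :
  \sum_(f in ffun_on (mem (Omega p m)))
     (\prod_(i < n) f i) * (complete_sym 'F_p n r).@[f] ^+ n =
  \sum_(M <- root_msets p n m) (multinom_coef n M)%:R * Theta n r M.
Proof.
pose tup (f : {ffun 'I_n -> 'F_p}) : n.-tuple 'F_p := [tuple f i | i < n].
rewrite (reindex (fun t : n.-tuple 'F_p => [ffun i => tnth t i])) /=; last first.
  exists tup => [t _|f _]; last by apply/ffunP => i; rewrite ffunE tnth_mktuple.
  by apply: eq_from_tnth => i; rewrite tnth_mktuple ffunE.
transitivity (\sum_(t : n.-tuple 'F_p | all (fun a => a \in Omega p m) t)
    Theta n r (seq_mset t)).
  apply: eq_big => [t|t _].
    apply/ffun_onP/all_tnthP => tO i; first by have := tO i; rewrite ffunE.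
    by rewrite ffunE; apply: tO.
  have perm_t := perm_eq_seq_mset t.
  rewrite Theta_seq ?(perm_size perm_t) ?size_tuple // !(perm_big _ perm_t) /=.
  rewrite big_tuple; congr (_ * _ ^+ n).
    by apply: eq_bigr => i _; rewrite ffunE.
  rewrite complete_sym_eval -coef_prod_geometric big_tuple.
  by under eq_bigr do rewrite ffunE.
(* Each tuple of roots is filed under its own multiset; the other tuples have none in
   [root_msets]. *)
transitivity (\sum_(M <- root_msets p n m)
    \sum_(t : n.-tuple 'F_p | seq_mset t == M) Theta n r M).
  under [RHS]eq_bigr do rewrite big_mkcond.
  rewrite exchange_big big_mkcond; apply: eq_bigr => t _ /=.
  have tO : (seq_mset t \in root_msets p n m) = all (fun a => a \in Omega p m) t.
    have perm_t := perm_eq_seq_mset t.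
    apply/root_msetsP/allP => [[_ sub] a|sub].
      by rewrite -(perm_mem perm_t); apply: sub.
    split; first by rewrite (perm_size perm_t) size_tuple.
    by move=> a; rewrite (perm_mem perm_t); apply: sub.
  case: ifPn => [t_in|t_notin].
    rewrite (bigD1_seq (seq_mset t)) ?fset_uniq ?tO //= eqxx big1 ?addr0 // => M.
    by rewrite eq_sym => /negPf->.
  rewrite big1_seq // => M /andP[_ MR]; case: eqP => // tM.
  by rewrite -tO tM MR in t_notin.
rewrite big_seq [RHS]big_seq; apply: eq_bigr => M /root_msetsP[szM _].
rewrite sumr_const mulr_natl multinom_coefE //; congr (_ *+ _).
(* The tuples listing [M], seen as sequences, are the members of [permutations M]. *)
pose T := [set t : n.-tuple 'F_p | seq_mset t == M].
have -> : #|[pred t : n.-tuple 'F_p | seq_mset t == M]| = #|T|.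
  by apply: eq_card => t; rewrite [RHS]inE.
rewrite cardE -(size_map val); apply/perm_size/uniq_perm.
- by rewrite map_inj_uniq ?enum_uniq //; apply: val_inj.
- exact: permutations_uniq.
move=> s; rewrite mem_permutations; apply/mapP/idP => [[t]|perm_s].
  rewrite mem_enum inE => /eqP <- ->.
  by rewrite perm_sym perm_eq_seq_mset.
have sz_s : size s == n by rewrite (perm_size perm_s) szM.
exists (Tuple sz_s) => //; rewrite mem_enum inE -[M in _ == M]seq_mset_id.
exact/eqP/eq_seq_msetP.
Qed.

Lemma perm_scale_mset l M : perm_eq (scale_mset l M) [seq l * a | a <- M].
Proof. exact: perm_eq_seq_mset. Qed.

Lemma size_scale_mset l M : size (scale_mset l M) = size M.
Proof. by rewrite (perm_size (perm_scale_mset l M)) size_map. Qed.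

Lemma scale_msetE l M a : l != 0 -> scale_mset l M (l * a) = M a.
Proof.
move=> l0; rewrite mset_seqE count_map -count_mem_mset; apply: eq_count => b /=.
by rewrite (inj_eq (mulfI l0)).
Qed.

Lemma scale_msetK l M : l != 0 -> scale_mset l^-1 (scale_mset l M) = M.
Proof.
move=> l0; apply/msetP => a.
by rewrite -{1}(mulKf l0 a) scale_msetE ?invr_eq0 // scale_msetE.
Qed.

(** Multiplication by [l] permutes ['F_p]. This one reindexing serves [max_mult], [num_max] and
    [multinom_coef]. *)
Lemma big_mset_scale (R : Type) (idx : R) (op : Monoid.com_law idx)
    (P : nat -> bool) (G : nat -> R) l M : l != 0 ->
  \big[op/idx]_(a | P (scale_mset l M a)) G (scale_mset l M a) =
  \big[op/idx]_(a | P (M a)) G (M a).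
Proof.
move=> l0; rewrite (reindex_inj (mulfI l0)) /=.
by apply: eq_big => a; rewrite scale_msetE.
Qed.

(** Makes the range independent of [M], as the reindexing by scaling requires. *)
Lemma big_msupp (R : Type) (idx : R) (op : Monoid.com_law idx) (G : nat -> R) M :
  G 0%N = idx ->
  \big[op/idx]_(a <- finsupp M) G (M a) = \big[op/idx]_a G (M a).
Proof.
move=> G0; rewrite big_uniq ?fset_uniq //= big_mkcond /=.
by apply: eq_bigr => a _; case: finsuppP => // _; rewrite G0.
Qed.

Lemma max_multE M : max_mult M = (\max_a M a)%N.
Proof. exact: (@big_msupp _ _ _ id). Qed.

Lemma max_mult_scale l M : l != 0 -> max_mult (scale_mset l M) = max_mult M.
Proof.
move=> l0; rewrite !max_multE.
exact: (@big_mset_scale _ _ _ xpredT id).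
Qed.

Lemma num_max_scale l M : l != 0 -> num_max (scale_mset l M) = num_max M.
Proof.
move=> l0; rewrite /num_max max_mult_scale // -!sum1dep_card.
exact: (@big_mset_scale _ _ _ (fun k => k == _) (fun _ => 1)).
Qed.

Lemma multinom_coef_scale l M : l != 0 ->
  multinom_coef n (scale_mset l M) = multinom_coef n M.
Proof.
move=> l0; rewrite /multinom_coef; congr (_ %/ _)%N.
rewrite !(@big_msupp _ _ _ factorial) //.
exact: (@big_mset_scale _ _ _ xpredT factorial).
Qed.

(** The product of the entries gains [l ^+ n] and [h_r ^+ n] gains [l ^+ (r * n)], together
    [(l ^+ r.+1) ^+ n = 1]. *)
Lemma Theta_scale l M : size M = n -> l ^+ r.+1 = 1 ->
  Theta n r (scale_mset l M) = Theta n r M.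
Proof.
move=> szM l1; rewrite !Theta_seq ?size_scale_mset //.
rewrite !(perm_big _ (perm_scale_mset l M)) /= !big_map.
rewrite big_split /= big_const_seq count_predT iter_mulr_1.
rewrite coef_prod_geometric_scale.
by rewrite exprMn mulrACA szM -exprMn -exprS l1 expr1n mul1r.
Qed.

Lemma Theta_uniq M : (1 < n)%N -> M \in root_msets p n r.+1 ->
  (max_mult M < 2)%N -> Theta n r M = 0.
Proof.
move=> n_gt1 /root_msetsP[szM MO] max_lt2.
rewrite Theta_seq // coef_prod_geometric_uniq ?szM //.
- by rewrite expr0n -(subnKC n_gt1) mulr0.
- apply: count_mem_uniq => a; rewrite count_mem_mset -mset_gt0.
  have : (M a < 2)%N.
    by rewrite (leq_ltn_trans _ max_lt2) // max_multE leq_bigmax.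
  by case: (M a) => [|[]].
- by apply/allP => a /MO; rewrite inE.
Qed.

(** As the maximum is positive, every element attaining it is an entry; for the empty multiset
    [num_max] would count all of ['F_p]. *)
Lemma num_max_gt0 M : prime p -> (0 < max_mult M)%N -> (0 < num_max M <= size M)%N.
Proof.
move=> p_pr max_gt0; apply/andP; split.
  have [a maxE] : {a | max_mult M = M a}.
    by rewrite max_multE; apply: eq_bigmax; rewrite card_Fp ?prime_gt0.
  by apply/card_gt0P; exists a; rewrite inE maxE.
apply: leq_trans (size_undup M); rewrite -(card_uniqP (undup_uniq M)).
apply/subset_leq_card/subsetP => a; rewrite inE mem_undup -mset_gt0.
by move/eqP->.
Qed.

(** Here [n < p] enters: [1 <= num_max M <= n < p], which makes division by [eta] legitimate. *)
Lemma num_max_neq0 M : prime p -> (n < p)%N -> size M = n -> (0 < max_mult M)%N ->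
  (num_max M)%:R != 0 :> 'F_p.
Proof.
move=> p_pr n_lt_p szM /(num_max_gt0 p_pr)/andP[num_gt0 num_le].
rewrite -(dvdn_pcharf (pchar_Fp p_pr)) gtnNdvd //.
by rewrite (leq_ltn_trans num_le) ?szM.
Qed.

End RootMultisets.

(** * Double counting, and the theorem *)

Lemma sum_max_root_msets p n r (F : {fset {mset 'F_p}}) :
  prime p -> (1 < n < p)%N -> (r.+1 %| p - 1)%N ->
  (F `<=` root_msets p n r.+1)%fset -> scaling_invariant r.+1 F ->
  \sum_(M <- F) (multinom_coef n M)%:R * Theta n r M =
  (r.+1)%:R * \sum_(M <- (F `&` max_root_msets p n r.+1)%fset)
    (multinom_coef n M)%:R / (num_max M)%:R * Theta n r M.
Proof.
move=> p_pr /andP[n_gt1 n_lt_p] m_dvd /fsubsetP F_sub F_scale.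
have [z z_prim] := primitive_root_Fp p_pr m_dvd.
have O_neq0 a : a \in Omega p r.+1 -> a != 0.
  by rewrite inE; apply: contraTneq => ->; rewrite expr0n eq_sym oner_neq0.
have szF (M : {mset 'F_p}) : M \in F -> size M = n by move=> /F_sub/root_msetsP[].
(* [K M] is the share of the weight of [M] given to each element of maximal multiplicity. *)
pose K (M : {mset 'F_p}) := (multinom_coef n M)%:R / (num_max M)%:R * Theta n r M.
have K_scale a M : a \in Omega p r.+1 -> M \in F -> K (scale_mset a M) = K M.
  move=> aO MF; rewrite /K multinom_coef_scale ?num_max_scale ?O_neq0 //.
  by rewrite Theta_scale ?szF //; apply/eqP; rewrite inE in aO.
(* First count: the [num_max M] equal shares restore the weight of [M], and multisets without
   repetition have weight [0]. *)
transitivity (\sum_(M <- F | (2 <= max_mult M)%N)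
    \sum_(a in Omega p r.+1 | M a == max_mult M) K M).
  rewrite [RHS]big_mkcond big_seq [RHS]big_seq; apply: eq_bigr => M MF.
  case: ifPn => [max_ge2|]; last first.
    by rewrite -ltnNge => /Theta_uniq -> //; rewrite ?mulr0 ?F_sub.
  have max_gt0 : (0 < max_mult M)%N by apply: leq_trans max_ge2.
  rewrite (eq_bigl [pred a | a \in [set a : 'F_p | M a == max_mult M]]); last first.
    move=> a; rewrite !inE; apply: andb_idl => /eqP Ma.
    have /root_msetsP[_ MO] := F_sub M MF.
    by have := MO a; rewrite -mset_gt0 Ma inE; apply.
  rewrite sumr_const -/(num_max M) /K -[RHS]mulr_natr mulrAC divfK //.
  by apply: (@num_max_neq0 p n); rewrite ?szF.
rewrite (exchange_big_dep (mem (Omega p r.+1))) /=; last by move=> M a _ /andP[].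
(* [m] is the sum of [a ^+ 0] over [Omega]. *)
rewrite -{1}[r.+1%:R]/(if (r.+1 %| 0)%N then r.+1%:R else 0).
rewrite -(sum_Omega_expr 0 z_prim) big_distrl /=; apply: eq_bigr => a aO.
rewrite expr0 mul1r.
have a0 := O_neq0 a aO.
have aVO : a^-1 \in Omega p r.+1.
  by move: aO; rewrite !inE exprVn invr_eq1.
(* Second count, for fixed [a]: scaling by [a] maps [G] bijectively onto the [M] in [F] whose
   maximum, at least [2], is attained at [a], and it preserves [K]. *)
pose G := (F `&` max_root_msets p n r.+1)%fset.
transitivity (\sum_(N <- G) K (scale_mset a N)); last first.
  rewrite big_seq [RHS]big_seq; apply: eq_bigr => N.
  by rewrite inE => /andP[NF _]; apply: K_scale.
rewrite -(big_map (scale_mset a) xpredT K) -[LHS]big_filter.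
apply/perm_big/uniq_perm; rewrite ?filter_uniq ?fset_uniq //.
  by rewrite map_inj_uniq ?fset_uniq //; apply: can_inj (fun M => scale_msetK M a0).
move=> M; rewrite mem_filter aO /=; apply/idP/mapP => [|[N]].
  case/andP=> /andP[max_ge2 /eqP Ma] MF; exists (scale_mset a^-1 M).
    rewrite !inE /= !max_mult_scale ?invr_eq0 // max_ge2 F_scale //= F_sub ?F_scale //.
    by rewrite andbT -(mulVf a0) scale_msetE ?invr_eq0 // Ma eqxx.
  by have := scale_msetK M (invr_neq0 a0); rewrite invrK => /esym.
rewrite !inE /= => /and4P[NF _ N1 max_ge2] ->.
rewrite F_scale // max_mult_scale // max_ge2 andbT /=.
by rewrite -[X in scale_mset a N X]mulr1 scale_msetE // N1.
Qed.

Theorem corollary2p6 (n r m p : nat) (n_ge3 : (3 <= n)%N) (m_def : m = r.+1)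
    (p_prime : prime p) (n_lt_p : (n < p)%N) (m_dvd : (m %| p - 1)%N) :
  ((magic_count n r)%:R : 'F_p) =
    m%:R ^ (1 - n%:Z) *
      \sum_(M <- max_root_msets p n m)
         (multinom_coef n M)%:R / (num_max M)%:R * Theta n r M
  /\
  (forall F : {fset {mset 'F_p}},
     (F `<=` root_msets p n m)%fset ->
     scaling_invariant m F ->
     contribution n m r F =
       m%:R ^ (1 - n%:Z) *
         \sum_(M <- (F `&` max_root_msets p n m)%fset)
            (multinom_coef n M)%:R / (num_max M)%:R * Theta n r M).
Proof.
subst m; have [z z_prim] := primitive_root_Fp p_prime m_dvd.
have m0 : (r.+1)%:R != 0 :> 'F_p by apply: prim_root_natf_neq0 z_prim.
have n_gt1 : (1 < n)%N by apply: ltnW.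
(* The claim on families comes first; the formula for [H_n(r)] is its case of the family of all
   multisets. *)
have family F : (F `<=` root_msets p n r.+1)%fset -> scaling_invariant r.+1 F ->
    contribution n r.+1 r F = (r.+1)%:R ^ (1 - n%:Z) *
      \sum_(M <- (F `&` max_root_msets p n r.+1)%fset)
        (multinom_coef n M)%:R / (num_max M)%:R * Theta n r M.
  move=> F_sub F_scale; rewrite /contribution sum_max_root_msets ?n_gt1 //.
  by rewrite mulrA -{2}[_%:R]expr1z -expfzDr // addrC.
split=> //.
have <- : (root_msets p n r.+1 `&` max_root_msets p n r.+1 =
           max_root_msets p n r.+1)%fset.
  by apply/fsetIidPr/fsubsetP => M; rewrite inE => /andP[].
rewrite -family ?fsubset_refl //.
  rewrite /contribution -sum_root_tuples (root_average _ z_prim) mulrA.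
  by rewrite exprnP -expfzDr // addNr expr0z mul1r.
move=> M l /root_msetsP[szM MO] lO; apply/root_msetsP; rewrite size_scale_mset.
split=> // b; rewrite (perm_mem (perm_scale_mset l M)) => /mapP[a /MO + ->].
by move: lO; rewrite !inE exprMn => /eqP-> /eqP->; rewrite mulr1.
Qed.
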